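(* Let $k\ge 2$, $n,m,r\ge 1$, and consider a $k$-valued control network $X_i(t+1)=f_i(X_1(t),\dots,X_n(t),U_1(t),\dots,U_m(t))$, $i\in[1,n]$, with algebraic form $x(t+1)=Lu(t)x(t)$, $L=[M_1,\dots,M_{k^m}]$, $M_\ell\in\mathcal{L}_{k^n\times k^n}$. Let $\mathcal{Z}=\mathcal{F}_\ell(Z_1,\dots,Z_r)$ be a dual subspace with structure matrix $G\in\mathcal{L}_{k^r\times k^n}$, and let $S_i:=\{j\in[1,k^n]\mid \mathrm{Col}_j(G)=\delta_{k^r}^i\}$ for $i\in[1,k^r]$. Then $\mathcal{Z}$ is a dual control-invariant subspace if and only if $$\bigcap_{j\in S_i}\Big(\bigcup_{\ell=1}^{k^m}\{\mathrm{Col}_j(GM_\ell)\}\Big)\neq\emptyset,\qquad \text{for all } i\in[1,k^r],$$ where for $S_i=\emptyset$ the condition is regarded as automatically satisfied.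
   Context: Notation. $[1,n]=\{1,\dots,n\}$; $\mathcal{D}_k=\{1,\dots,k\}$; $\delta_n^i$ is the $i$-th column of $I_n$; $\Delta_n=\{\delta_n^1,\dots,\delta_n^n\}$; $\mathrm{Col}_j(A)$ is the $j$-th column of $A$; $\mathcal{L}_{p\times q}$ is the set of $p\times q$ logical matrices (all columns in $\Delta_p$). Control network. $X_i,U_j\in\mathcal{D}_k$ and $f_i:\mathcal{D}_k^{n+m}\to\mathcal{D}_k$ are arbitrary functions. A value $j\in\mathcal{D}_k$ is identified with $\delta_k^j$. Write $x_i\in\Delta_k$ for the vector form of $X_i$, $x=x_1\otimes\cdots\otimes x_n\in\Delta_{k^n}$, and similarly $u=u_1\otimes\cdots\otimes u_m\in\Delta_{k^m}$. $L\in\mathcal{L}_{k^n\times k^{n+m}}$ is the unique logical matrix with $x(t+1)=L(u(t)\otimes x(t))$ (written $Lu(t)x(t)$), split into $k^m$ equal blocks $M_\ell\in\mathcal{L}_{k^n\times k^n}$, so $M_\ell x=L(\delta_{k^m}^\ell\otimes x)$. Dual subspaces. For $k$-valued logical functions $Z_i=g_i(X_1,\dots,X_n)$, $i\in[1,r]$, $\mathcal{Z}=\mathcal{F}_\ell(Z_1,\dots,Z_r)$ is the set of all $k$-valued logical functions of $Z_1,\dots,Z_r$. Its structure matrix is the unique $G\in\mathcal{L}_{k^r\times k^n}$ with $z:=z_1\otimes\cdots\otimes z_r=Gx$, $z_i\in\Delta_k$ being the vector form of $Z_i$. Dual control-invariance. $\mathcal{Z}$ is a dual control-invariant subspace of the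 control network if there is $H\in\mathcal{L}_{k^r\times k^r}$ such that for every initial state $x(0)\in\Delta_{k^n}$ there is a control sequence $\{u(t)\mid t\ge 0\}$ for which the controlled trajectory satisfies $z(t+1)=Hz(t)$ for all $t\ge0$, where $z(t)=Gx(t)$. *)

(* Defs.v *)
From HB Require Import structures.
From mathcomp Require Import all_boot all_order all_algebra.
From mathcomp Require Import boolp classical_sets.
From mathcomp.real_closed Require Import mxtens.

Set Implicit Arguments.
Unset Strict Implicit.
Unset Printing Implicit Defensive.

Import GRing.Theory.
Local Open Scope classical_set_scope.
Local Open Scope ring_scope.

(* Conventions. The index sets {1, ..., k} are rendered by 'I_k, so they start
   at 0. The entries 0 and 1 of logical matrices live in an arbitrary
   nontrivial commutative ring R. *)

Section LogicalMatrices.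
Variable R : comNzRingType.

Definition delta (n : nat) (i : 'I_n) : 'cV[R]_n := col i 1%:M.

Definition Delta (n : nat) : set 'cV[R]_n := range (@delta n).

Definition logical_mx (p q : nat) (A : 'M[R]_(p, q)) : Prop :=
  forall j, Delta (col j A).

(* v_1 (x) ... (x) v_n, associated to the right; the cast only identifies
   k * k ^ n with k ^ n.+1. *)
Fixpoint kron (k n : nat) : ('I_n -> 'cV[R]_k) -> 'cV[R]_(k ^ n) :=
  match n with
  | 0 => fun _ => 1%:M
  | n'.+1 => fun v =>
      castmx (esym (expnS k n'), muln1 1)
        (v ord0 *t kron (fun i => v (lift ord0 i)))
  end.

(* L = [M_1, ..., M_p]: mxtens_index (l, j) is the column l * q + j of L. *)
Definition block (s p q : nat) (L : 'M[R]_(s, p * q)) (l : 'I_p) : 'M[R]_(s, q) :=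
  \matrix_(i, j) L i (mxtens_index (l, j)).

End LogicalMatrices.

Arguments delta R {n} i.
Arguments Delta R n : clear implicits.

Definition state (k n : nat) := {ffun 'I_n -> 'I_k}.

Definition logical_fun (k n : nat) := state k n -> 'I_k.

Definition vform (R : comNzRingType) (k n : nat) (X : state k n) : 'cV[R]_(k ^ n) :=
  kron (fun i => delta R (X i)).

Arguments vform R {k n} X.

Definition network (k n m : nat) := 'I_n -> state k n -> state k m -> 'I_k.

Definition step (k n m : nat) (f : network k n m) (X : state k n) (U : state k m) :
  state k n := [ffun i => f i X U].

Fixpoint trajectory (k n m : nat) (f : network k n m) (X0 : state k n)
    (U : nat -> state k m) (t : nat) : state k n :=
  if t is t'.+1 then step f (trajectory f X0 U t') (U t') else X0.

(* The number of columns k ^ (n + m) is written k ^ m * k ^ n, the height of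
   u (x) x. *)
Definition algebraic_form (R : comNzRingType) (k n m : nat) (f : network k n m)
    (L : 'M[R]_(k ^ n, k ^ m * k ^ n)) : Prop :=
  logical_mx L /\
  forall X U, vform R (step f X U) = L *m (vform R U *t vform R X).

Definition apply_funs (k n r : nat) (g : 'I_r -> logical_fun k n) (X : state k n) :
  state k r := [ffun i => g i X].

Definition F_ell (k n r : nat) (g : 'I_r -> logical_fun k n) :
    set (logical_fun k n) :=
  [set h | exists phi : logical_fun k r, h = phi \o apply_funs g].

(* A dual subspace is presented by its generators Z_1, ..., Z_r: its structure
   matrix depends on them. *)
Record dual_subspace (k n r : nat) := DualSubspace {
  dual_set : set (logical_fun k n);
  generator : 'I_r -> logical_fun k n;
  dual_setE : dual_set = F_ell generator
}.

Definition structure_matrix (R : comNzRingType) (k n r : nat)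
    (Z : dual_subspace k n r) (G : 'M[R]_(k ^ r, k ^ n)) : Prop :=
  logical_mx G /\
  forall X, vform R (apply_funs (generator Z) X) = G *m vform R X.

(* The initial states x(0) and the controls u(t) are given by their components;
   by vform_range this is the same as ranging over Delta R (k ^ n) and
   Delta R (k ^ m). *)
Definition dual_control_invariant (R : comNzRingType) (k n m r : nat)
    (f : network k n m) (Z : dual_subspace k n r) : Prop :=
  exists2 G : 'M[R]_(k ^ r, k ^ n), structure_matrix Z G &
  exists2 H : 'M[R]_(k ^ r), logical_mx H &
  forall X0 : state k n, exists U : nat -> state k m,
    let z t := G *m vform R (trajectory f X0 U t) in
    forall t, z t.+1 = H *m z t.

Arguments dual_control_invariant R {k n m r} f Z.

Definition col_fiber (R : comNzRingType) (p q : nat) (G : 'M[R]_(p, q)) (i : 'I_p) :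
    set 'I_q :=
  [set j | col j G = delta R i].

Section Facts.
Variable R : comNzRingType.

Lemma delta_inj n : injective (@delta R n).
Proof.
move=> i j /matrixP /(_ i 0); rewrite !mxE eqxx.
by case: eqP => // _ /eqP; rewrite oner_eq0.
Qed.

Lemma mul_delta p q (A : 'M[R]_(p, q)) j : A *m delta R j = col j A.
Proof. by rewrite /delta !colE mul1mx. Qed.

Lemma tens_delta p q (i : 'I_p) (j : 'I_q) :
  delta R i *t delta R j = delta R (mxtens_index (i, j)).
Proof.
apply/matrixP=> a b; case: (mxtens_indexP a) => a1 a2.
rewrite !mxE mxtens_indexK /= -natrM mulnb; congr (_%:R).
by rewrite -xpair_eqE (inj_eq (can_inj (@mxtens_indexK _ _))).
Qed.

Lemma castmx_delta n n' (e : n = n') e' (i : 'I_n) :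
  castmx (e, e') (delta R i) = delta R (cast_ord e i).
Proof.
by case: n' / e; rewrite (eq_irrelevance e' (erefl _)) castmx_id cast_ord_id.
Qed.

Lemma block_mul s p q (L : 'M[R]_(s, p * q)) l (x : 'cV[R]_q) :
  Delta R q x -> block L l *m x = L *m (delta R l *t x).
Proof.
move=> [j _ <-]; rewrite tens_delta !mul_delta.
by apply/matrixP=> a b; rewrite !mxE.
Qed.

Lemma vformS k n (X : state k n.+1) :
  vform R X = castmx (esym (expnS k n), muln1 1)
    (delta R (X ord0) *t vform R ([ffun i => X (lift ord0 i)] : state k n)).
Proof.
rewrite /vform /=; congr (castmx _ (_ *t _)); congr kron.
by apply: funext => i; rewrite ffunE.
Qed.

Lemma vform_range k n : range (@vform R k n) = Delta R (k ^ n).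
Proof.
elim: n => [|n IH].
  apply/seteqP; split=> [_ [X _ <-]|_ [i _ <-]].
    by exists ord0 => //; apply/matrixP=> a b; rewrite !mxE !ord1.
  exists ([ffun i : 'I_0 => False_rect 'I_k (notF (ltn_ord i))] : state k 0) => //.
  by apply/matrixP=> a b; rewrite !mxE !ord1.
apply/seteqP; split=> [_ [X _ <-]|_ [i _ <-]].
  rewrite vformS.
  have [j _ <-] : Delta R (k ^ n) (vform R ([ffun i => X (lift ord0 i)] : state k n)).
    by rewrite -IH; eexists.
  by rewrite tens_delta castmx_delta; eexists.
have [j ->] : exists j, i = cast_ord (esym (expnS k n)) j.
  by exists (cast_ord (expnS k n) i); rewrite cast_ordK.
case: (mxtens_indexP j) => a b {i j}.
have [Y _ Yb] : range (@vform R k n) (delta R b) by rewrite IH; exists b.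
exists ([ffun i => oapp Y a (unlift ord0 i)] : state k n.+1) => //.
rewrite vformS ffunE unlift_none /=.
set Y' := [ffun _ => _] : state k n; have -> : Y' = Y.
  by apply/ffunP=> i; rewrite !ffunE liftK.
by rewrite Yb tens_delta castmx_delta.
Qed.

Lemma vform_inj k n : injective (@vform R k n).
Proof.
elim: n => [|n IH] X Y; first by move=> _; apply/ffunP=> -[].
rewrite !vformS => /(can_inj (castmxK _ _)).
set X' := [ffun _ => _] : state k n; set Y' := [ffun _ => _] : state k n.
have [x _ xX] : Delta R (k ^ n) (vform R X') by rewrite -vform_range; eexists.
have [y _ yY] : Delta R (k ^ n) (vform R Y') by rewrite -vform_range; eexists.
rewrite -xX -yY !tens_delta => /delta_inj /(can_inj (@mxtens_indexK _ _)) [XY xy].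
have /ffunP XY' : X' = Y' by apply: IH; rewrite -xX -yY xy.
apply/ffunP=> i; case: (unliftP ord0 i) => [j|] -> //.
by have := XY' j; rewrite !ffunE.
Qed.

Lemma mx_of_fun_exists p q (F : 'I_q -> 'cV[R]_p) : (forall j, Delta R p (F j)) ->
  exists2 A : 'M[R]_(p, q), logical_mx A & forall j, A *m delta R j = F j.
Proof.
move=> DF; have E j : col j (\matrix_(i, j) F j i 0) = F j.
  by apply/matrixP=> a b; rewrite !mxE ord1.
by exists (\matrix_(i, j) F j i 0) => j; rewrite ?mul_delta E.
Qed.

Lemma eq_mx_delta p q (A B : 'M[R]_(p, q)) :
  (forall j, A *m delta R j = B *m delta R j) -> A = B.
Proof.
move=> AB; apply/matrixP=> i j; have /matrixP /(_ i 0) := AB j.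
by rewrite !mul_delta !mxE.
Qed.

Lemma structure_matrix_unique k n r (Z : dual_subspace k n r) :
  exists! G : 'M[R]_(k ^ r, k ^ n), structure_matrix Z G.
Proof.
have VE (j : 'I_(k ^ n)) : exists X : state k n, vform R X = delta R j.
  have : range (@vform R k n) (delta R j) by rewrite vform_range; exists j.
  by case=> X _ XE; exists X.
have [X XE] := choice VE.
have [|G LG GE] :=
    @mx_of_fun_exists _ _ (fun j => vform R (apply_funs (generator Z) (X j))).
  by move=> j; rewrite -vform_range; eexists.
exists G; split=> [|G' [_ G'E]].
  split=> // Y; have [j _ jY] : Delta R (k ^ n) (vform R Y).
    by rewrite -vform_range; eexists.
  rewrite -jY GE; congr (vform R (apply_funs _ _)).
  by apply: vform_inj; rewrite XE jY.
by apply: eq_mx_delta => j; rewrite GE G'E XE.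
Qed.

Lemma algebraic_form_unique k n m (f : network k n m) :
  exists! L : 'M[R]_(k ^ n, k ^ m * k ^ n), algebraic_form f L.
Proof.
have VE (j : 'I_(k ^ m * k ^ n)) : exists UX : state k m * state k n,
    vform R UX.1 *t vform R UX.2 = delta R j.
  case: (mxtens_indexP j) => a b.
  have [U _ UE] : range (@vform R k m) (delta R a) by rewrite vform_range; exists a.
  have [X _ XE] : range (@vform R k n) (delta R b) by rewrite vform_range; exists b.
  by exists (U, X); rewrite UE XE tens_delta.
have [V VE'] := choice VE.
have [|L LL LE] := @mx_of_fun_exists _ _ (fun j => vform R (step f (V j).2 (V j).1)).
  by move=> j; rewrite -vform_range; eexists.
exists L; split=> [|L' [_ L'E]].
  split=> // X U.
  have [a _ aU] : Delta R (k ^ m) (vform R U) by rewrite -vform_range; eexists.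
  have [b _ bX] : Delta R (k ^ n) (vform R X) by rewrite -vform_range; eexists.
  have := VE' (mxtens_index (a, b)); rewrite -aU -bX tens_delta LE.
  case: (V _) => U1 X1 /=.
  have [a1 _ aU1] : Delta R (k ^ m) (vform R U1) by rewrite -vform_range; eexists.
  have [b1 _ bX1] : Delta R (k ^ n) (vform R X1) by rewrite -vform_range; eexists.
  rewrite -aU1 -bX1 tens_delta => /delta_inj /(can_inj (@mxtens_indexK _ _)) [ea eb].
  have -> : U1 = U by apply: (@vform_inj k m); rewrite -aU1 -aU ea.
  by have -> : X1 = X by apply: (@vform_inj k n); rewrite -bX1 -bX eb.
by apply: eq_mx_delta => j; rewrite LE -VE' L'E.
Qed.

End Facts.

(* Main.v *)
(* If H exists, then at time 0 every state x with G x = delta_i is steered to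
   H delta_i in z-coordinates, so column i of H lies in the i-th intersection.
   Conversely, choosing a point of each nonempty intersection as a column of H
   gives a one-step feedback law u(x) with G L u(x) x = H G x; recording the
   controls along the closed-loop trajectory yields the control sequence. *)

Require Import Defs.
From mathcomp Require Import all_boot all_order all_algebra.
From mathcomp Require Import boolp classical_sets.

Local Open Scope classical_set_scope.
Local Open Scope ring_scope.

Lemma exists_vform_delta (R : comNzRingType) (k n : nat) (j : 'I_(k ^ n)) :
  exists X : state k n, vform R X = delta R j.
Proof.
have [X _ XE] : range (@vform R k n) (delta R j) by rewrite vform_range; exists j.
by exists X.
Qed.

Lemma exists_delta_vform (R : comNzRingType) (k n : nat) (X : state k n) :
  exists j : 'I_(k ^ n), vform R X = delta R j.
Proof.
have [j _ jE] : Delta R (k ^ n) (vform R X) by rewrite -vform_range; exists X.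
by exists j.
Qed.

(** [dual_control_invariant] supplies its own structure matrix; this identifies it with the given
    [G]. *)
Lemma structure_matrix_eq {R : comNzRingType} {k n r : nat}
    {Z : dual_subspace k n r} {G G' : 'M[R]_(k ^ r, k ^ n)} :
  structure_matrix Z G -> structure_matrix Z G' -> G = G'.
Proof.
have [G0 [_ uniqG0]] := structure_matrix_unique R Z.
by move=> /uniqG0 <- /uniqG0 <-.
Qed.

Lemma mul_vform_step {R : comNzRingType} {k n m p : nat} {f : network k n m}
    {L : 'M[R]_(k ^ n, k ^ m * k ^ n)} (G : 'M[R]_(p, k ^ n))
    {X : state k n} {U : state k m} {j : 'I_(k ^ n)} {l : 'I_(k ^ m)} :
  algebraic_form f L -> vform R X = delta R j -> vform R U = delta R l ->
  G *m vform R (step f X U) = col j (G *m block L l).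
Proof.
move=> [_ LE] Xj Ul; rewrite LE Xj Ul -mul_delta -mulmxA block_mul //.
by exists j.
Qed.

(** The controls depend on the very trajectory they generate. Iterating the closed-loop map first,
    as [Y], breaks this circle: the open-loop sequence [u \o Y] then reproduces [Y]. *)
Lemma feedback_trajectory {k n m : nat} (f : network k n m)
    (u : state k n -> state k m) (X0 : state k n) :
  exists U, forall t,
    trajectory f X0 U t.+1 = step f (trajectory f X0 U t) (u (trajectory f X0 U t)).
Proof.
pose Y t := iter t (fun X => step f X (u X)) X0.
exists (u \o Y); have E t : trajectory f X0 (u \o Y) t = Y t.
  by elim: t => //= t ->.
by move=> t; rewrite /= E.
Qed.

Theorem corollary8 (R : comNzRingType) (k n m r : nat)
    (hk : (2 <= k)%N) (hn : (1 <= n)%N) (hm : (1 <= m)%N) (hr : (1 <= r)%N)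
    (f : network k n m)
    (L : 'M[R]_(k ^ n, k ^ m * k ^ n)) (hL : algebraic_form f L)
    (Z : dual_subspace k n r)
    (G : 'M[R]_(k ^ r, k ^ n)) (hG : structure_matrix Z G) :
  dual_control_invariant R f Z <->
  forall i : 'I_(k ^ r), col_fiber G i !=set0 ->
    \bigcap_(j in col_fiber G i)
      \bigcup_(l : 'I_(k ^ m)) [set col j (G *m block L l)] !=set0.
Proof.
split=> [[G' hG' [H _ HE]] i _|cap].
  exists (col i H) => j /= Gj.
  have [X Xj] := exists_vform_delta R k n j.
  have [U /(_ 0%N)] := HE X.
  have [l Ul] := exists_delta_vform R k m (U 0%N).
  rewrite (structure_matrix_eq hG' hG) /= (mul_vform_step _ hL Xj Ul).
  by rewrite Xj mul_delta Gj mul_delta => <-; exists l.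
have FE i : exists v : 'cV[R]_(k ^ r), Delta R (k ^ r) v /\
    forall j, col_fiber G i j -> exists l, v = col j (G *m block L l).
  have [/[dup] [[j0 Gj0]] /cap [v vcap]|empty] := pselect (col_fiber G i !=set0).
    exists v; split=> [|j /vcap [l _ ->]]; last by exists l.
    (* That [v] is a logical vector comes from the fiber point [j0]: there [v] is the [z]-vector of
       a successor state. *)
    have [l _ ->] := vcap j0 Gj0.
    have [X Xj] := exists_vform_delta R k n j0.
    have [U Ul] := exists_vform_delta R k m l.
    rewrite -(mul_vform_step _ hL Xj Ul) -hG.2 -vform_range.
    by eexists.
  (* Empty fiber: an arbitrary logical column as default, to keep [H] logical. *)
  exists (delta R i); split=> [|j Gj]; first by exists i.
  by case: empty; exists j.
have [F FP] := choice FE.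
have [|H LH HE] := @mx_of_fun_exists R _ _ F; first by move=> i; have [] := FP i.
have uE X : exists U : state k m, G *m vform R (step f X U) = H *m (G *m vform R X).
  have [j Xj] := exists_delta_vform R k n X.
  (* Since [G] is logical, [j] lies in the fiber of some [i], so [F i], which is column [i] of [H],
     is attained from [j] by some block [l]. *)
  have [i _ ij] := hG.1 j.
  have [l Fl] := (FP i).2 j (esym ij).
  have [U Ul] := exists_vform_delta R k m l.
  exists U; rewrite (mul_vform_step _ hL Xj Ul) Xj mul_delta -ij.
  by rewrite HE.
have [u uP] := choice uE.
exists G => //; exists H => // X0.
have [U UE] := feedback_trajectory f u X0.
by exists U => z t; rewrite /z UE uP.
Qed.
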